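(* Let $T>0$, and let $g_1=[g_1^{jk}(x)]_{j,k=0}^n$ and $g_2=[g_2^{jk}(x)]_{j,k=0}^n$ be the inverse metric tensors of two time-independent Lorentzian metrics $g_1^{-1}$ and $g_2^{-1}$ on $\mathbb{R}\times\mathbb{R}^n$. Suppose that the lengths of geodesics satisfy $$R(g_1,T,\hat y,\hat\eta)=R(g_2,T,\hat y,\hat\eta)$$ for all $\hat y=(0,y)$ with $y\in\mathbb{R}^n$ and all $\hat\eta=(\eta_0,\eta)\in\mathbb{R}\times\mathbb{R}^n$. Then the metrics $g_1^{-1}$ and $g_2^{-1}$ are equal, i.e. $g_1^{jk}(y)=g_2^{jk}(y)$ for all $y\in\mathbb{R}^n$ and $0\le j,k\le n$.
   Context: Coordinates on $\mathbb{R}\times\mathbb{R}^n$ are $(x_0,x)$, where $x_0$ is time and $x=(x_1,\dots,x_n)$ are the space variables. A (time-independent) Lorentzian metric is $\sum_{j,k=0}^n g_{jk}(x)\,dx_j\,dx_k$, where $[g_{jk}(x)]_{j,k=0}^n$ is a smooth, symmetric matrix function of $x\in\mathbb{R}^n$ only, of signature $(+,-,\dots,-)$. Its inverse matrix is $g=[g^{jk}(x)]_{j,k=0}^n$, called the inverse metric tensor; the metric itself is denoted $g^{-1}=[g_{jk}]$. The Hamiltonian is $H(x,\xi_0,\xi)=\frac12\sum_{j,k=0}^n g^{jk}(x)\xi_j\xi_k$. For $\hat y=(0,y)$, $\hat\eta=(\eta_0,\eta)$, let $(x_0(t),x(t),\xi_0(t),\xi(t))$ be the solution of $$\frac{dx}{dt}=\frac{\partial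 H}{\partial\xi},\quad \frac{d\xi}{dt}=-\frac{\partial H}{\partial x},\quad \frac{dx_0}{dt}=\frac{\partial H}{\partial\xi_0},\quad \frac{d\xi_0}{dt}=0,$$ with $x_0(0)=0$, $x(0)=y$, $\xi(0)=\eta$, $\xi_0(0)=\eta_0$, assumed to exist for $0\le t\le T$. The curve $(x_0(t),x(t))$ is the space-time geodesic starting at $(\hat y,\hat\eta)$. Its length in the metric $g^{-1}$ is $$R(g,T,\hat y,\hat\eta)=\int_0^T\sqrt{\sum_{j,k=0}^n g_{jk}(x(t))\frac{dx_j}{dt}\frac{dx_k}{dt}}\;dt .$$ The expression under the root is real; when it is negative the root is taken as the principal complex square root, so that $R$ is defined for all $\hat y,\hat\eta$. *)

(* Defs.v *)
From HB Require Import structures.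
From mathcomp Require Import all_boot all_order all_algebra.
From mathcomp Require Import all_classical all_reals all_analysis.
From mathcomp Require Import complex.

Set Implicit Arguments.
Unset Strict Implicit.
Unset Printing Implicit Defensive.

Import Order.TTheory GRing.Theory Num.Theory.
Import numFieldNormedType.Exports.

Local Open Scope classical_set_scope.
Local Open Scope complex_scope.
Local Open Scope ring_scope.

Section Geodesics.
Context {R : realType} {n : nat}.

Fixpoint is_Ck (k : nat) (f : 'rV[R]_n -> R) : Prop :=
  if k is k'.+1 then
    (forall x, differentiable f x) /\
    (forall i : 'I_n, is_Ck k' (fun x => 'D_(delta_mx 0 i) f x))
  else continuous f.

Definition is_smooth (f : 'rV[R]_n -> R) : Prop := forall k, is_Ck k f.

Definition minkowski : 'M[R]_n.+1 :=
  diag_mx (\row_(j < n.+1) if j == 0 then 1 else -1).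

(* Sylvester's law of inertia makes this the signature of the quadratic form
   with matrix [A]; index 0 is time. *)
Definition lorentz_signature (A : 'M[R]_n.+1) : Prop :=
  exists2 P : 'M[R]_n.+1, P \in unitmx & P *m A *m P^T = minkowski.

Definition lorentz_metric (G : 'rV[R]_n -> 'M[R]_n.+1) : Prop :=
  [/\ forall j k, is_smooth (fun x => G x j k),
      forall x, (G x)^T = G x &
      forall x, lorentz_signature (G x)].

Definition inverse_metric_tensor (g : 'rV[R]_n -> 'M[R]_n.+1) : Prop :=
  exists2 G, lorentz_metric G & forall x, g x = invmx (G x).

(* The vector (a, v_1, ..., v_n) of R x R^n, with a at index 0. *)
Definition hat (a : R) (v : 'rV[R]_n) : 'rV[R]_n.+1 := row_mx a%:M v.

Implicit Types g : 'rV[R]_n -> 'M[R]_n.+1.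

Definition hamiltonian g (x : 'rV[R]_n) (xi0 : R) (xi : 'rV[R]_n) : R :=
  2^-1 * \sum_(j < n.+1) \sum_(k < n.+1)
    g x j k * hat xi0 xi 0 j * hat xi0 xi 0 k.

(* On the closed time interval [0, T], "solution" means: continuous on [0, T]
   and satisfying the equations on ]0, T[; the equations then hold at the end
   points too, with one-sided derivatives. *)
Definition is_bicharacteristic g (T : R) (y : 'rV[R]_n)
    (eta0 : R) (eta : 'rV[R]_n)
    (x0 : R -> R) (x : R -> 'rV[R]_n) (xi0 : R -> R) (xi : R -> 'rV[R]_n) :
    Prop :=
  [/\ [/\ x0 0 = 0, x 0 = y, xi0 0 = eta0 & xi 0 = eta],
      [/\ {within `[0, T], continuous x0}, {within `[0, T], continuous x},
          {within `[0, T], continuous xi0} &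
          {within `[0, T], continuous xi}] &
      forall t, 0 < t < T ->
      [/\ forall i : 'I_n, is_derive t 1 (fun s => x s 0 i)
            ('D_(delta_mx 0 i) (fun p => hamiltonian g (x t) (xi0 t) p) (xi t)),
          forall i : 'I_n, is_derive t 1 (fun s => xi s 0 i)
            (- 'D_(delta_mx 0 i)
                 (fun q => hamiltonian g q (xi0 t) (xi t)) (x t)),
          is_derive t 1 x0
            ('D_1 (fun p0 => hamiltonian g (x t) p0 (xi t)) (xi0 t)) &
          is_derive t 1 xi0 0]].

(* The matrix [g_jk] is [invmx (g x)], since [g] is the inverse tensor. *)
Definition speed2 g (x0 : R -> R) (x : R -> 'rV[R]_n) (t : R) : R :=
  \sum_(j < n.+1) \sum_(k < n.+1)
    invmx (g (x t)) j k * derive1 (fun s => hat (x0 s) (x s) 0 j) t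
                        * derive1 (fun s => hat (x0 s) (x s) 0 k) t.

Definition complex_integral (D : set R) (f : R -> R[i]) : R[i] :=
  (\int[lebesgue_measure]_(t in D) complex.Re (f t))%R
  +i* (\int[lebesgue_measure]_(t in D) complex.Im (f t))%R.

Definition curve_length g (T : R) (x0 : R -> R) (x : R -> 'rV[R]_n) : R[i] :=
  complex_integral `[0, T] (fun t => sqrtc (speed2 g x0 x t)%:C).

Definition geodesics_exist g (T : R) : Prop :=
  forall y eta0 eta, exists x0 x xi0 xi,
    is_bicharacteristic g T y eta0 eta x0 x xi0 xi.

(* R(g, T, (0, y), (eta0, eta)); the solution, hence the value, is unique by
   the Cauchy-Lipschitz theorem; the default 0 is used only if there is no
   solution on [0, T]. *)
Definition geodesic_length g (T : R) (y : 'rV[R]_n)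
    (eta0 : R) (eta : 'rV[R]_n) : R[i] :=
  xget 0 [set l | exists x0 x xi0 xi,
    is_bicharacteristic g T y eta0 eta x0 x xi0 xi /\
    l = curve_length g T x0 x].

End Geodesics.

(* Main.v *)
(* Along a bicharacteristic the velocity of the geodesic is g xi, so the
   integrand of the length is the square root of (g xi)^T g^-1 (g xi) = 2 H.
   The Hamiltonian H is conserved, hence every solution has length
   T sqrt(2 H(y, eta_0, eta)), whether or not it is the only one. Squaring, the
   lengths determine the quadratic form 2 H(y, .), and by polarization its
   matrix g(y). *)

Require Import Defs.
From mathcomp Require Import all_boot all_order all_algebra.
From mathcomp Require Import all_classical all_reals all_analysis.
From mathcomp Require Import measurable_realfun complex ring.

Import Order.TTheory GRing.Theory Num.Theory.
Import numFieldNormedType.Exports.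

Local Open Scope ring_scope.

(** * Bilinear forms as matrix products *)

Lemma bilinear_formE {R : comPzRingType} {m : nat} (A : 'M[R]_m)
    (u w : 'rV[R]_m) :
  (u *m A *m w^T) 0 0 = \sum_j \sum_k A j k * u 0 j * w 0 k.
Proof.
rewrite mxE exchange_big/=; apply: eq_bigr => k _.
by rewrite !mxE mulr_suml; apply: eq_bigr => j _; rewrite [A j k * _]mulrC.
Qed.

Lemma bilinear_form_sym {R : comPzRingType} {m : nat} (A : 'M[R]_m)
    (u w : 'rV[R]_m) :
  A^T = A -> (w *m A *m u^T) 0 0 = (u *m A *m w^T) 0 0.
Proof.
move=> symA; suff -> : w *m A *m u^T = (u *m A *m w^T)^T by rewrite [LHS]mxE.
by rewrite !trmx_mul trmxK symA mulmxA.
Qed.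

(** * Differentiation of matrix expressions, and integrals of constants *)

Section Calculus.
Context {R : realType}.

Lemma differentiable_sum_seq {V : normedModType R} {I : Type} (r : seq I)
    (P : pred I) (f : I -> V -> R) (x : V) :
  (forall i, differentiable (f i) x) ->
  differentiable (fun y => \sum_(i <- r | P i) f i y) x.
Proof.
move=> df; elim: r => [|i r IH].
  by under eq_fun do rewrite big_nil; exact: differentiable_cst.
under eq_fun do rewrite big_cons.
by case: (P i) => //; apply: differentiableD.
Qed.

Lemma differentiable_prod_seq {V : normedModType R} {I : Type} (r : seq I)
    (P : pred I) (f : I -> V -> R) (x : V) :
  (forall i, differentiable (f i) x) ->
  differentiable (fun y => \prod_(i <- r | P i) f i y) x.
Proof.
move=> df; elim: r => [|i r IH].
  by under eq_fun do rewrite big_nil; exact: differentiable_cst.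
under eq_fun do rewrite big_cons.
by case: (P i) => //; apply: differentiableM.
Qed.

(** By the Leibniz expansion, to which [\det] unfolds, the determinant is a finite sum of signed
    products of entries. *)
Lemma differentiable_det {V : normedModType R} {m : nat}
    (A : V -> 'M[R]_m) (x : V) :
  (forall j k, differentiable (fun y => A y j k) x) ->
  differentiable (fun y => \det (A y)) x.
Proof.
move=> dA; apply: differentiable_sum_seq => s.
apply: differentiableM; first exact: differentiable_cst.
exact: differentiable_prod_seq.
Qed.

(** Cramer's rule: an entry of the inverse is a cofactor, itself a signed determinant, divided by
    the nonzero determinant. Invertibility at every point resolves the case distinction inside
    [invmx]. *)
Lemma differentiable_invmx {V : normedModType R} {m : nat}
    (A : V -> 'M[R]_m) (x : V) (j k : 'I_m) :
  (forall y, A y \in unitmx) ->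
  (forall j k, differentiable (fun y => A y j k) x) ->
  differentiable (fun y => invmx (A y) j k) x.
Proof.
move=> uA dA; rewrite /invmx; under eq_fun do rewrite uA !mxE.
apply: differentiableM.
  apply: differentiableV; first exact: differentiable_det.
  by have := uA x; rewrite unitmxE unitfE.
apply: differentiableM; first exact: differentiable_cst.
by apply: differentiable_det => a b; under eq_fun do rewrite !mxE.
Qed.

Lemma is_derive_sum_ord {V : normedModType R} {m : nat}
    (f : 'I_m -> V -> R) (df : 'I_m -> R) (x v : V) :
  (forall i, is_derive x v (f i) (df i)) ->
  is_derive x v (fun y => \sum_(i < m) f i y) (\sum_(i < m) df i).
Proof.
move=> H; have := @is_derive_sum _ _ _ _ f x v df H.
by congr is_derive; apply/funext => y; rewrite fct_sumE.
Qed.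

Lemma is_derive_mul {V : normedModType R} (f g : V -> R) (df dg : R)
    (x v : V) :
  is_derive x v f df -> is_derive x v g dg ->
  is_derive x v (fun y => f y * g y) (df * g x + f x * dg).
Proof.
move=> Hf Hg; have H := is_deriveM Hf Hg.
refine (is_derive_eq H _).
by rewrite addrC; congr (_ + _); exact: mulrC.
Qed.

Lemma is_derive_quadratic_form {V : normedModType R} {m : nat}
    (A : V -> 'M[R]_m) (u : V -> 'rV[R]_m) (dA : 'M[R]_m) (du : 'rV[R]_m)
    (x v : V) :
  (forall j k, is_derive x v (fun y => A y j k) (dA j k)) ->
  (forall j, is_derive x v (fun y => u y 0 j) (du 0 j)) ->
  is_derive x v
    (fun y => \sum_(j < m) \sum_(k < m) A y j k * u y 0 j * u y 0 k)
    ((u x *m dA *m (u x)^T + du *m A x *m (u x)^T + u x *m A x *m du^T) 0 0).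
Proof.
move=> HA Hu.
have H : is_derive x v
    (fun y => \sum_(j < m) \sum_(k < m) A y j k * u y 0 j * u y 0 k)
    (\sum_(j < m) \sum_(k < m) (dA j k * u x 0 j * u x 0 k +
      A x j k * du 0 j * u x 0 k + A x j k * u x 0 j * du 0 k)).
  apply: is_derive_sum_ord => j; apply: is_derive_sum_ord => k.
  refine (is_derive_eq (is_derive_mul _ _ _ _ _ _
    (is_derive_mul _ _ _ _ _ _ (HA j k) (Hu j)) (Hu k)) _).
  by rewrite mulrDl.
refine (is_derive_eq H _).
rewrite mxE [X in X + _]mxE !bilinear_formE -!big_split/=.
by apply: eq_bigr => j _; rewrite !big_split.
Qed.

(** The chain rule, with the velocity given coordinate by coordinate as in Hamilton's equations. *)
Lemma is_derive_comp_curve {n : nat} (f : 'rV[R]_n -> R) (x : R -> 'rV[R]_n)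
    (dx : 'I_n -> R) (t : R) :
  differentiable f (x t) ->
  (forall i, is_derive t 1 (fun s => x s 0 i) (dx i)) ->
  is_derive t 1 (fun s => f (x s))
    (\sum_(i < n) dx i * 'D_(delta_mx 0 i) f (x t)).
Proof.
move=> df Hx.
have dcx : derivable x t 1.
  by apply/derivable_mxP => i j; rewrite ord1; case: (Hx j).
have /derivable1_diffP dxt := dcx.
apply: DeriveDef.
  by apply/derivable1_diffP; apply: differentiable_comp.
rewrite -derive1E derive1E'; last exact: differentiable_comp.
rewrite diff_comp //=.
rewrite -(deriveE _ dxt).
rewrite derive_mx//.
(* The velocity is expanded in the canonical basis; linearity of the differential then produces the
   partial derivatives. *)
set v := (X in 'd f _ X); rewrite (row_sum_delta v) linear_sum/=.
apply: eq_bigr => i _; rewrite linearZ/= deriveE// /v mxE.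
by have := Hx i => -[_ ->].
Qed.

Lemma continuous_mul {X : topologicalType} (f h : X -> R) :
  continuous f -> continuous h -> continuous (fun s => f s * h s).
Proof. by move=> cf ch s; apply: continuousM; [exact: cf|exact: ch]. Qed.

(** The end points form a null set. They must be discarded because Hamilton's equations are only
    given on the open interval, so the integrand of the length is not controlled at 0 and [T]. *)
Lemma Rintegral_itvcc_cst (a b c : R) (f : R -> R) : a < b ->
  (forall t, a < t < b -> f t = c) ->
  (\int[lebesgue_measure]_(t in `[a, b]) f t)%R = c * (b - a).
Proof.
move=> ab fc.
rewrite /Rintegral integral_itv_bndoo; last first.
  apply: (eq_measurable_fun (cst c%:E)) => [t|].
    by rewrite inE/= in_itv/= => /fc ->.
  exact: measurable_cst.
rewrite (eq_integral (cst c%:E)) => [|t]; last first.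
  by rewrite inE/= in_itv/= => /fc ->.
rewrite integral_cst//= lebesgue_measure_itv/= lte_fin.
by rewrite ab -EFinB -EFinM.
Qed.

End Calculus.

(** * Space-time vectors and the differential of the Hamiltonian *)

Section Geodesics.
Local Open Scope classical_set_scope.
Local Open Scope ring_scope.
Context {R : realType} {n : nat}.
Implicit Types x y v : 'rV[R]_n.

Lemma hat0 (a : R) v : hat a v 0 0 = a.
Proof.
rewrite /hat (_ : 0 = lshift n (0 : 'I_1)); last exact/val_inj.
by apply: etrans (row_mxEl _ _ _ _) _; rewrite mxE eqxx.
Qed.

Lemma hatS (a : R) v (i : 'I_n) : hat a v 0 (rshift 1 i) = v 0 i.
Proof. exact: (row_mxEr _ _ _ _). Qed.

Lemma hat_surj (u : 'rV[R]_n.+1) : exists a v, u = hat a v.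
Proof.
exists (lsubmx (u : 'rV_(1 + n)) 0 0), (rsubmx (u : 'rV_(1 + n))).
by rewrite /hat -mx11_scalar hsubmxK.
Qed.

Lemma ord_succP (P : 'I_n.+1 -> Prop) :
  P 0 -> (forall i : 'I_n, P (rshift 1 i)) -> forall j, P j.
Proof.
move=> P0 PS j; case: (splitP (j : 'I_(1 + n))) => i /= e.
  by suff -> : j = 0 by []; apply/val_inj; rewrite /= e ord1.
by suff -> : j = rshift 1 i by []; exact/val_inj.
Qed.

Lemma is_derive_hat {V : normedModType R} (a : V -> R) (w : V -> 'rV[R]_n)
    (da : R) (dw : 'rV[R]_n) (p q : V) :
  is_derive p q a da ->
  (forall i, is_derive p q (fun s => w s 0 i) (dw 0 i)) ->
  forall j, is_derive p q (fun s => hat (a s) (w s) 0 j) (hat da dw 0 j).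
Proof.
move=> Ha Hw; apply: ord_succP => [|i].
  by under eq_fun do rewrite hat0; rewrite hat0.
by under eq_fun do rewrite hatS; rewrite hatS.
Qed.

Lemma is_derive_coord (p v : 'rV[R]_n) i :
  is_derive p v (fun q : 'rV[R]_n => q 0 i) (v 0 i).
Proof.
have did : derivable (id : 'rV[R]_n -> 'rV[R]_n) p v by exact: derivable_id.
apply: DeriveDef; first exact/diff_derivable/differentiable_coord.
by have /matrixP/(_ 0 i) := derive_mx did; rewrite derive_id mxE.
Qed.

Lemma mulmx_hat_tr (w : 'rV[R]_n.+1) (a : R) v :
  (w *m (hat a v)^T) 0 0 =
  w 0 0 * a + \sum_(i < n) w 0 (rshift 1 i) * v 0 i.
Proof.
rewrite mxE big_ord_recl [_^T _ _]mxE hat0; congr (_ + _).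
apply: eq_bigr => i _; rewrite [_^T _ _]mxE.
by rewrite (_ : lift ord0 i = rshift 1 i) ?hatS//; exact/val_inj.
Qed.

Lemma hamiltonianE (g : 'rV[R]_n -> 'M[R]_n.+1) x a v :
  hamiltonian g x a v = 2^-1 * (hat a v *m g x *m (hat a v)^T) 0 0.
Proof. by rewrite bilinear_formE. Qed.

(** Position, energy and momentum vary together here, so that the partial derivatives of the
    Hamiltonian and its derivative along the flow are all instances of one formula. *)
Lemma is_derive_hamiltonian {V : normedModType R}
    (g : 'rV[R]_n -> 'M[R]_n.+1) (x : V -> 'rV[R]_n) (a : V -> R)
    (v : V -> 'rV[R]_n) (dA : 'M[R]_n.+1) (da : R) (dv : 'rV[R]_n) (p q : V) :
  (g (x p))^T = g (x p) ->
  (forall j k, is_derive p q (fun s => g (x s) j k) (dA j k)) ->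
  is_derive p q a da ->
  (forall i, is_derive p q (fun s => v s 0 i) (dv 0 i)) ->
  is_derive p q (fun s => hamiltonian g (x s) (a s) (v s))
    (2^-1 * (hat (a p) (v p) *m dA *m (hat (a p) (v p))^T) 0 0
     + (hat (a p) (v p) *m g (x p) *m (hat da dv)^T) 0 0).
Proof.
move=> symg HA Ha Hv.
have H := is_derive_quadratic_form (fun s => g (x s)) _ _ _ _ _ HA
  (is_derive_hat _ _ _ _ _ _ Ha Hv).
have H2 := is_derive_mul _ _ _ _ _ _ (is_derive_cst (2^-1 : R) p q) H.
refine (is_derive_eq H2 _).
(* By symmetry of [g] the two terms that differentiate the momentum coincide, which absorbs the
   factor one half. *)
have E (b c : R) : 2^-1 * (b + c + c) = 2^-1 * b + c by field.
rewrite mul0r add0r [cst _ _]/= mxE [X in _ * (X + _)]mxE -E.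
by rewrite (bilinear_form_sym _ _ (hat da dv)).
Qed.

(** * Partial derivatives of the Hamiltonian of a fixed tensor *)

Variable g : 'rV[R]_n -> 'M[R]_n.+1.
Hypothesis gsym : forall x, (g x)^T = g x.
Hypothesis gunit : forall x, g x \in unitmx.
Hypothesis gdiff : forall x j k, differentiable (fun y => g y j k) x.

Let dg (i : 'I_n) x : 'M[R]_n.+1 :=
  \matrix_(j, k) 'D_(delta_mx 0 i) (fun y => g y j k) x.

Lemma derive_hamiltonian_space x a v i :
  'D_(delta_mx 0 i) (fun q => hamiltonian g q a v) x =
  2^-1 * (hat a v *m dg i x *m (hat a v)^T) 0 0.
Proof.
have HA j k : is_derive x (delta_mx 0 i) (fun s => g s j k) (dg i x j k).
  by rewrite mxE; apply/derivableP/diff_derivable.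
have Hv k : is_derive x (delta_mx 0 i) (fun=> v 0 k) ((0 : 'rV[R]_n) 0 k).
  by rewrite mxE; exact: is_derive_cst.
have [_ ->] := is_derive_hamiltonian _ (fun q => q) _ _ _ _ _ _ _ (gsym x) HA
  (is_derive_cst a _ _) Hv.
rewrite [X in _ + X](_ : _ = 0) ?addr0//.
by rewrite /hat raddf0 row_mx0 trmx0 mulmx0 mxE.
Qed.

Lemma derive_hamiltonian_momentum x a v i :
  'D_(delta_mx 0 i) (fun p => hamiltonian g x a p) v =
  (hat a v *m g x) 0 (rshift 1 i).
Proof.
have HA j k : is_derive v (delta_mx 0 i) (fun=> g x j k)
    ((0 : 'M[R]_n.+1) j k).
  by rewrite mxE; exact: is_derive_cst.
have [_ ->] := is_derive_hamiltonian _ (fun=> x) _ _ _ _ _ _ _ (gsym x) HA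
  (is_derive_cst a _ _) (is_derive_coord _ _).
rewrite mulmx0 mul0mx mxE mulr0 add0r mulmx_hat_tr mulr0 add0r.
rewrite (bigD1 i)//= big1 ?addr0 => [|j ji].
  by rewrite [delta_mx _ _ _ _]mxE !eqxx mulr1.
by rewrite [delta_mx _ _ _ _]mxE (negbTE ji) mulr0.
Qed.

Lemma derive_hamiltonian_energy x a v :
  'D_1 (fun p => hamiltonian g x p v) a = (hat a v *m g x) 0 0.
Proof.
have HA j k : is_derive a 1 (fun=> g x j k) ((0 : 'M[R]_n.+1) j k).
  by rewrite mxE; exact: is_derive_cst.
have Hv k : is_derive a 1 (fun=> v 0 k) ((0 : 'rV[R]_n) 0 k).
  by rewrite mxE; exact: is_derive_cst.
have [_ ->] := is_derive_hamiltonian _ (fun=> x) _ _ _ _ _ _ _ (gsym x) HA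
  (is_derive_id _ _) Hv.
rewrite mulmx0 mul0mx mxE mulr0 add0r mulmx_hat_tr mulr1 big1 ?addr0// => j _.
by rewrite [X in _ * X]mxE mulr0.
Qed.

(** * Conservation of energy and the length of a geodesic *)

Section Bicharacteristic.
Variables (T : R) (y : 'rV[R]_n) (eta0 : R) (eta : 'rV[R]_n).
Variables (x0 : R -> R) (x : R -> 'rV[R]_n).
Variables (xi0 : R -> R) (xi : R -> 'rV[R]_n).
Hypothesis bich : is_bicharacteristic g T y eta0 eta x0 x xi0 xi.

Lemma is_derive_position t j : 0 < t < T ->
  is_derive t 1 (fun s => hat (x0 s) (x s) 0 j)
    ((hat (xi0 t) (xi t) *m g (x t)) 0 j).
Proof.
case: bich => _ _ ode /ode[dx _ dx0 _].
(* Splitting the velocity into time and space parts matches it with the two separate equations for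
   [x0] and [x]. *)
have [b [w bw]] := hat_surj (hat (xi0 t) (xi t) *m g (x t)).
rewrite bw.
refine (is_derive_hat x0 x b w t 1 _ _ j) => [|i].
  refine (is_derive_eq dx0 _).
  by rewrite derive_hamiltonian_energy bw hat0.
refine (is_derive_eq (dx i) _).
by rewrite derive_hamiltonian_momentum bw hatS.
Qed.

(** The position contributes the sum of the products of dH/dxi_i and dH/dx_i, the momentum
    contributes its opposite, and [xi0] contributes nothing since its derivative is 0. *)
Lemma is_derive_hamiltonian_flow t : 0 < t < T ->
  is_derive t 1 (fun s => hamiltonian g (x s) (xi0 s) (xi s)) 0.
Proof.
case: bich => _ _ ode /ode[dx dxi dx0 dxi0].
have {}dxi i : is_derive t 1 (fun s => xi s 0 i)
    ((\row_i - 'D_(delta_mx 0 i)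
       (fun q => hamiltonian g q (xi0 t) (xi t)) (x t)) 0 i).
  by rewrite mxE.
pose u := hat (xi0 t) (xi t).
(* Chain rule for [g] along the curve: the matrices [dg i] are weighted by the spatial velocity,
   which is the spatial part of [u *m g (x t)]. *)
have HA j k : is_derive t 1 (fun s => g (x s) j k)
    ((\sum_(i < n) (u *m g (x t)) 0 (rshift 1 i) *: dg i (x t)) j k).
  have := is_derive_comp_curve (fun y => g y j k) _ _ _ (gdiff _ _ _) dx.
  congr is_derive; rewrite summxE; apply: eq_bigr => i _.
  by rewrite derive_hamiltonian_momentum !mxE.
refine (is_derive_eq
  (is_derive_hamiltonian _ _ _ _ _ _ _ _ _ (gsym _) HA dxi0 dxi) _).
rewrite -/u mulmx_hat_tr mulr0 add0r mulmx_sumr mulmx_suml summxE mulr_sumr.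
rewrite -big_split/= big1// => i _.
rewrite -scalemxAr -scalemxAl [X in _ * X + _]mxE [(\row__ _) _ _]mxE.
by rewrite derive_hamiltonian_space mulrN mulrCA subrr.
Qed.

(** The mean value theorem on the segment from 0 to [t]: the derivative vanishes inside, and
    continuity up to the boundary links the interior to the initial data. *)
Lemma hamiltonian_flow t : 0 <= t <= T ->
  hamiltonian g (x t) (xi0 t) (xi t) = hamiltonian g y eta0 eta.
Proof.
move=> /andP[t0 tT].
case: (bich) => -[_ xy xi0eta0 xieta] [_ cx cxi0 cxi] _.
rewrite -{}xy -{}xi0eta0 -{}xieta.
have cH : {within `[0, T], continuous
    (fun s => hamiltonian g (x s) (xi0 s) (xi s))}.
  apply: continuous_mul; first exact: cst_continuous.
  apply: continuous_big => [|j _]; first exact: add_continuous.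
  apply: continuous_big => [|k _]; first exact: add_continuous.
  (* Continuity is relative to the closed interval, so coordinates are composed with curves seen as
     maps on the subspace. *)
  have chat l : {within `[0, T], continuous (fun s => hat (xi0 s) (xi s) 0 l)}.
    apply: (ord_succP (fun l => {within `[0, T],
      continuous (fun s => hat (xi0 s) (xi s) 0 l)})) => [|i].
      by rewrite (_ : (fun s => _) = xi0)//; apply/funext => s; exact: hat0.
    rewrite (_ : (fun s => _) = (fun s => xi s 0 i)); last first.
      by apply/funext => s; exact: hatS.
    move=> s; apply: (@continuous_comp (subspace `[0, T]) _ _ xi
      (fun v : 'rV[R]_n => v 0 i)).
      exact: cxi.
    exact: coord_continuous.
  apply: continuous_mul; last exact: chat.
  apply: continuous_mul; last exact: chat.
  move=> s; apply: (@continuous_comp (subspace `[0, T]) _ _ x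
    (fun q => g q j k)).
    exact: cx.
  exact: (differentiable_continuous (gdiff _ _ _)).
have [||c _] := @MVT_segment R
  (fun s => hamiltonian g (x s) (xi0 s) (xi s)) (fun=> 0) 0 t t0.
- move=> s; rewrite in_itv/= => /andP[s0 st].
  by apply: is_derive_hamiltonian_flow; rewrite s0 (lt_le_trans st).
- apply: continuous_subspaceW cH => s/=; rewrite !in_itv/= => /andP[-> st]/=.
  exact: le_trans tT.
- by rewrite mul0r => /eqP; rewrite subr_eq0 => /eqP.
Qed.

(** With velocity [u *m g], one factor [g] cancels against [invmx g] and leaves the form of [g] at
    [u], which is twice the conserved Hamiltonian. *)
Lemma speed2_flow t : 0 < t < T ->
  speed2 g x0 x t = 2 * hamiltonian g y eta0 eta.
Proof.
move=> tT; pose u := hat (xi0 t) (xi t).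
rewrite -(hamiltonian_flow t); last by case/andP: tT => *; rewrite !ltW.
have dhat j : derive1 (fun s => hat (x0 s) (x s) 0 j) t = (u *m g (x t)) 0 j.
  by rewrite derive1E; case: (is_derive_position t j tT).
rewrite /speed2; under eq_bigr do under eq_bigr do rewrite !dhat.
rewrite -bilinear_formE hamiltonianE mulrA mulfV ?pnatr_eq0// mul1r.
by rewrite mulmxK// trmx_mul gsym mulmxA.
Qed.

Lemma curve_length_flow (T_gt0 : 0 < T) :
  curve_length g T x0 x =
  sqrtc (2 * hamiltonian g y eta0 eta)%:C%C * T%:C%C.
Proof.
set c := sqrtc _; have sqrt_speed2 t : 0 < t < T ->
    sqrtc (speed2 g x0 x t)%:C%C = c by move=> /speed2_flow ->.
rewrite /curve_length /complex_integral.
(* The constant [c] is imaginary when the Hamiltonian is negative, so both its real and imaginary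
   parts are integrated. *)
rewrite (Rintegral_itvcc_cst 0 T (complex.Re c))// => [|t /sqrt_speed2 ->//].
rewrite (Rintegral_itvcc_cst 0 T (complex.Im c))// => [|t /sqrt_speed2 ->//].
by rewrite subr0; case: (c) => a b; simpc.
Qed.

End Bicharacteristic.

(** The set inside [xget] is nonempty by existence, and [curve_length_flow] gives all its elements
    the same value; [xget] therefore returns this value rather than its default. *)
Lemma geodesic_lengthE (T : R) y eta0 eta : 0 < T -> geodesics_exist g T ->
  geodesic_length g T y eta0 eta =
  sqrtc (2 * hamiltonian g y eta0 eta)%:C%C * T%:C%C.
Proof.
move=> T0 /(_ y eta0 eta)[x0 [x [xi0 [xi b]]]].
apply: xget_unique => [|l [z0 [z [zi0 [zi [b' ->]]]]]].
  exists x0, x, xi0, xi; split=> //.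
  by rewrite (curve_length_flow _ _ _ _ _ _ _ _ b).
exact: curve_length_flow b' T0.
Qed.

End Geodesics.

(** * Recovering the tensor from its quadratic form *)

Lemma inverse_metric_tensorP {R : realType} {n : nat}
    (g : 'rV[R]_n -> 'M[R]_n.+1) : inverse_metric_tensor g ->
  [/\ forall x, (g x)^T = g x, forall x, g x \in unitmx &
      forall x j k, differentiable (fun y => g y j k) x].
Proof.
move=> [G [Gsmooth Gsym Glor] gG].
(* A congruence takes [G x] to the Minkowski matrix, whose determinant is a product of factors 1 and
   -1; hence every factor of the congruence is invertible. *)
have uG x : G x \in unitmx.
  have [P uP PGP] := Glor x.
  have : (Defs.minkowski : 'M[R]_n.+1) \in unitmx.
    rewrite unitmxE det_diag unitfE prodf_seq_neq0; apply/allP => i _ /=.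
    by rewrite mxE; case: ifP => _; rewrite ?oppr_eq0 oner_eq0.
  by rewrite -PGP !unitmx_mul => /andP[/andP[]].
split=> x; rewrite ?gG ?unitmx_inv// ?trmx_inv ?Gsym// => j k.
rewrite (_ : (fun _ => _) = (fun y => invmx (G y) j k)); last first.
  by apply/funext => y; rewrite gG.
apply: differentiable_invmx => // a b.
by have [] := Gsmooth a b 1%N.
Qed.

(** Polarization: the difference [C] is symmetric and its quadratic form vanishes, so evaluating at
    the sum of the basis vectors j and k leaves twice the entry [C j k]. *)
Lemma quadratic_form_inj {R : realType} {m : nat} (A B : 'M[R]_m) :
  A^T = A -> B^T = B ->
  (forall u : 'rV[R]_m, (u *m A *m u^T) 0 0 = (u *m B *m u^T) 0 0) -> A = B.
Proof.
move=> symA symB AB.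
pose C := A - B.
have symC j k : C k j = C j k.
  by rewrite -[in LHS](trmxK C) mxE /C linearB/= symA symB.
have C0 (u : 'rV[R]_m) : (u *m C *m u^T) 0 0 = 0.
  by rewrite /C mulmxBr mulmxBl [LHS]mxE [X in _ + X]mxE AB subrr.
have CE j k : (delta_mx 0 j *m C *m (delta_mx 0 k)^T : 'M[R]_1) 0 0 = C j k.
  by rewrite -rowE trmx_delta -colE !mxE.
apply/eqP; rewrite -subr_eq0; apply/eqP/matrixP => j k; rewrite [RHS]mxE -/C.
have add_form (M N : 'M[R]_1) : (M + N) 0 0 = M 0 0 + N 0 0 by rewrite mxE.
have := C0 (delta_mx 0 j + delta_mx 0 k).
rewrite [_^T]linearD mulmxDr !mulmxDl !add_form !C0 !CE symC add0r addr0.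
by move/eqP; rewrite -mulr2n mulrn_eq0/= => /eqP.
Qed.

Theorem theorem2p1 (R : realType) (n : nat) (T : R)
  (g1 g2 : 'rV[R]_n -> 'M[R]_n.+1)
  (T_gt0 : 0 < T)
  (g1_inv : inverse_metric_tensor g1)
  (g2_inv : inverse_metric_tensor g2)
  (g1_ex : geodesics_exist g1 T)
  (g2_ex : geodesics_exist g2 T)
  (eq_length : forall (y : 'rV[R]_n) (eta0 : R) (eta : 'rV[R]_n),
     geodesic_length g1 T y eta0 eta = geodesic_length g2 T y eta0 eta) :
  forall (y : 'rV[R]_n) (j k : 'I_n.+1), g1 y j k = g2 y j k.
Proof.
move=> y; suff -> : g1 y = g2 y by [].
have [sym1 unit1 diff1] := inverse_metric_tensorP _ g1_inv.
have [sym2 unit2 diff2] := inverse_metric_tensorP _ g2_inv.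
apply: quadratic_form_inj => // u.
have [a [v ->]] := hat_surj u.
suff : 2 * hamiltonian g1 y a v = 2 * hamiltonian g2 y a v.
  by rewrite !hamiltonianE !mulrA mulfV ?pnatr_eq0// !mul1r.
have := eq_length y a v.
rewrite !geodesic_lengthE//.
(* Both lengths carry the same factor [T], which is cancelled as a nonzero complex number. *)
have T_neq0 : T%:C%C != 0 :> R[i] by rewrite fmorph_eq0 gt_eqF.
move=> /(mulIf T_neq0) eq_sqrt.
(* The square of [sqrtc z] is [z] for every complex [z], so squaring recovers the Hamiltonian
   whatever its sign. *)
apply: complexI.
by rewrite -[LHS]sqr_sqrtc eq_sqrt sqr_sqrtc.
Qed.
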